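(* For all integers $k$ and $\ell$ with $2\le\ell\le k-1$, $\mathrm{Deviation}[\ell]\not\Rightarrow\mathrm{Deviation}[\ell+1]$; that is, there exists a sequence $\{H_n\}_{n\to\infty}$ of $k$-uniform hypergraphs with $|V(H_n)|=n$ that satisfies $\mathrm{Deviation}[\ell]$ but does not satisfy $\mathrm{Deviation}[\ell+1]$.
   Context: A $k$-uniform hypergraph $H$ is a pair of finite sets $(V(H),E(H))$ where $E(H)$ is a collection of $k$-subsets of $V(H)$. For $2\le\ell\le k$, a sequence $\{H_n\}_{n\to\infty}$ of $k$-uniform hypergraphs with $|V(H_n)|=n$ satisfies $\mathrm{Deviation}[\ell]$ if $$\sum_{\substack{x_1,\dots,x_{k-\ell}\in V(H_n)\\ y_{1,0},y_{1,1},\dots,y_{\ell,0},y_{\ell,1}\in V(H_n)}}(-1)^{|\mathcal{O}[\vec x,\vec y]\cap E(H_n)|}=o(n^{k+\ell}),$$ where $\mathcal{O}[\vec x,\vec y]=\{\{x_1,\dots,x_{k-\ell},y_{1,i_1},\dots,y_{\ell,i_\ell}\}:0\le i_j\le1\}$ (the vertices in the sum are not required to be distinct). *)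

(* Defs.v *)
(* MathComp with MathComp-Analysis *)
From mathcomp Require Import all_boot all_order all_algebra.
From mathcomp Require Import all_classical all_reals all_analysis.

Set Implicit Arguments.
Unset Strict Implicit.
Unset Printing Implicit Defensive.

Import Order.TTheory GRing.Theory Num.Theory.
Import numFieldNormedType.Exports.

Local Open Scope ring_scope.

Record uniform_hypergraph (k : nat) := UniformHypergraph {
  vertices : finType;
  edges : {set {set vertices}};
  edges_uniform : forall e : {set vertices}, e \in edges -> #|e| = k
}.

Arguments vertices {k} H : rename.
Arguments edges {k} H : rename.

(* A set of sets: when vertices coincide, coinciding members are counted once
   and members may have fewer than m + l elements. *)
Definition octahedron (V : finType) (m l : nat)
    (x : {ffun 'I_m -> V}) (y : {ffun 'I_l * bool -> V}) : {set {set V}} :=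
  [set ([set x a | a : 'I_m] :|: [set y (j, i j) | j : 'I_l])%SET
     | i : {ffun 'I_l -> bool}].

Definition deviation_sum (R : pzRingType) (k l : nat)
    (H : uniform_hypergraph k) : R :=
  \sum_(x : {ffun 'I_(k - l) -> vertices H})
    \sum_(y : {ffun 'I_l * bool -> vertices H})
      (-1) ^+ #|(octahedron x y :&: edges H)%SET|.

Local Open Scope classical_set_scope.

(* Intended for 2 <= l <= k and #|vertices (H n)| = n. *)
Definition deviation (R : realType) (k l : nat)
    (H : nat -> uniform_hypergraph k) : Prop :=
  (fun n => deviation_sum R l (H n)) =o_\oo (fun n => n%:R ^+ (k + l) : R).

(* Main.v *)
Require Import Defs.
From mathcomp Require Import all_boot all_order all_algebra.
From mathcomp Require Import all_classical all_reals all_analysis.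
From mathcomp Require Import fintype finset zify ring lra.

(** Fix a vertex set [V] of size [n] and a family [g] of subsets of [V].
    Declare a [k]-set [e] an edge when the number of [l]-sets of [g] inside [e]
    is odd. Attach the sign
    [(-1) ^+ (T \in g)] to an [l]-set [T]; then the sign of [e] is the product
    of the signs of its [l]-subsets. Say that a configuration [(x, y)] is
    nondegenerate when all its vertices are distinct. For such a configuration,
    multiplying over the corners of the octahedron shows that its sign is the
    product over [l]-sets [T] of the sign of [T] raised to the number of corners
    containing [T] ([octahedron_sign]), so only the parity of that number
    counts.

    With [l + 1] directions, an [l]-set misses at least one direction
    altogether; flipping the choice made in this direction pairs up the corners
    containing it. Every exponent is even, every nondegenerate configuration
    contributes 1, and the degenerate ones are fewer than the others by a factor
    of order [n]: the sum is at least [n ^ (k + l + 1)] up to lower order,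
    whatever [g] is ([deviation_sum_succ_ge]).

    With [l] directions, [g] is chosen by a second moment argument. The top face
    [{y (j, true) | j}] of a nondegenerate configuration is an [l]-set lying in
    exactly one corner, and in no corner of a second configuration disjoint from
    the first. Toggling its membership in [g] therefore negates the first sign
    and keeps the second, so the product of the two signs averages to 0 over all
    [g]. Expanding the square of the deviation sum, only the pairs of
    configurations with a repeated vertex survive, and there are
    [O(n ^ (2 (k + l) - 1))] of them; some [g] does at least as well as the
    average ([ex_small_deviation_sum]), giving a deviation sum
    [O(n ^ (k + l - 1/2))]. *)

Set Implicit Arguments.
Unset Strict Implicit.
Unset Printing Implicit Defensive.

Import Order.TTheory GRing.Theory Num.Theory.
Import numFieldNormedType.Exports.

Local Open Scope ring_scope.

(** * Counting maps that are not injective *)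

Section Counting.

(** Turns a sum over pairs of configurations into a sum over single maps, so
    that a coincidence inside or between them is one failure of injectivity. *)
Lemma sum_ffun_split (Z : nmodType) (A B V : finType)
    (F : {ffun A -> V} -> {ffun B -> V} -> Z) :
  \sum_(f : {ffun A -> V}) \sum_(g : {ffun B -> V}) F f g =
  \sum_(h : {ffun A + B -> V}) F [ffun a => h (inl a)] [ffun b => h (inr b)].
Proof.
rewrite pair_bigA /=.
pose restr (h : {ffun A + B -> V}) :=
  ([ffun a => h (inl a)] : {ffun A -> V}, [ffun b => h (inr b)] : {ffun B -> V}).
pose glue (p : {ffun A -> V} * {ffun B -> V}) : {ffun A + B -> V} :=
  [ffun s => match s with inl a => p.1 a | inr b => p.2 b end].
rewrite (reindex restr) //=.
exists glue => [h _ | [f g] _]; first by apply/ffunP => -[a|b]; rewrite !ffunE.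
by congr pair; apply/ffunP => a; rewrite !ffunE.
Qed.

Lemma expn_le_ffact n N : (n ^ N <= n ^_ N + N ^ 2 * n ^ N.-1)%N.
Proof.
elim: N => [|N IH]; first by rewrite ffactn0 expn0.
have le_ffact : (n ^_ N <= n ^ N)%N.
  elim: N {IH} => [|N IH]; first by rewrite ffactn0.
  by rewrite ffactnSr expnSr leq_mul ?leq_subr.
rewrite ffactnSr /= expnSr.
have step : (N ^ 2 * n ^ N.-1 * n = N ^ 2 * n ^ N)%N.
  by case: N {IH le_ffact} => [|N] /=; [rewrite !mul0n | rewrite -mulnA -expnSr].
have le_n : (n <= n - N + N)%N by lia.
have := leq_mul IH (leqnn n); rewrite mulnDl step => le1.
have := leq_mul (leqnn (n ^_ N)) le_n; rewrite mulnDr => le2.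
have := leq_mul le_ffact (leqnn N) => le3.
nia.
Qed.

Definition noninj (D V : finType) : {set {ffun D -> V}} :=
  [set h : {ffun D -> V} | ~~ injectiveb h].

Lemma card_noninj_le (D V : finType) :
  (#|noninj D V| <= #|D| ^ 2 * #|V| ^ #|D|.-1)%N.
Proof.
have := cardsC [set h : {ffun D -> V} | injectiveb h].
rewrite card_inj_ffuns card_ffun.
have -> : ~: [set h : {ffun D -> V} | injectiveb h] = noninj D V.
  by apply/setP => h; rewrite !inE.
by move=> card_all; rewrite -(leq_add2l (#|V| ^_ #|D|)) card_all expn_le_ffact.
Qed.

End Counting.

(** * The corners of an octahedron *)

Section Corners.
Variables (V : finType) (m l : nat).
Implicit Types (x : {ffun 'I_m -> V}) (y : {ffun 'I_l * bool -> V}).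
Implicit Types (i : {ffun 'I_l -> bool}) (T : {set V}).

Definition corner x y i : {set V} :=
  [set x a | a : 'I_m] :|: [set y (j, i j) | j : 'I_l].

Definition joint_inj x y :=
  [/\ injective x, injective y & forall a p, x a != y p].

Lemma joint_inj_parts (h : {ffun 'I_m + 'I_l * bool -> V}) :
  injective h ->
  joint_inj [ffun a => h (inl a)] [ffun p => h (inr p)].
Proof.
move=> h_inj; split=> [a b|p q|a p]; rewrite !ffunE.
- by move/h_inj => [].
- by move/h_inj => [].
- by apply/eqP => /h_inj.
Qed.

Lemma mem_cornery x y i j b :
  joint_inj x y -> (y (j, b) \in corner x y i) = (i j == b).
Proof.
move=> [_ y_inj xy]; rewrite inE; apply/orP/eqP => [[]|<-].
- by case/imsetP => a _ /eqP; rewrite eq_sym (negbTE (xy _ _)).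
- by case/imsetP => j' _ /y_inj [-> ->].
- by right; apply/imsetP; exists j.
Qed.

Lemma card_corner x y i : joint_inj x y -> #|corner x y i| = (m + l)%N.
Proof.
move=> [x_inj y_inj xy]; rewrite cardsU.
have -> : [set x a | a : 'I_m] :&: [set y (j, i j) | j : 'I_l] = set0.
  apply/setP => v; rewrite !inE; apply/negP => /andP[/imsetP[a _ ->]].
  by case/imsetP => j _ /eqP; rewrite (negbTE (xy _ _)).
rewrite cards0 subn0 !card_imset ?card_ord //.
by move=> j j' /y_inj [].
Qed.

Lemma corner_inj x y : joint_inj x y -> injective (corner x y).
Proof.
move=> inj i i' eq_c; apply/ffunP => j; apply/eqP.
by rewrite eq_sym -(mem_cornery _ _ _ inj) -eq_c mem_cornery.
Qed.

Definition corners_above x y T := #|[set i | T \subset corner x y i]|.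

Definition top_face y : {set V} := [set y (j, true) | j : 'I_l].

Lemma card_top_face x y : joint_inj x y -> #|top_face y| = l.
Proof. by case=> _ y_inj _; rewrite card_imset ?card_ord // => j j' /y_inj []. Qed.

(** The top face meets every direction at its [true] vertex, which forces the
    choice function of a corner containing it. *)
Lemma corners_above_top_face x y :
  joint_inj x y -> corners_above x y (top_face y) = 1%N.
Proof.
move=> inj; apply/eqP/cards1P; exists [ffun => true].
apply/setP => i; rewrite !inE; apply/subsetP/eqP => [sub | -> v].
  apply/ffunP => j; rewrite ffunE; apply/eqP.
  by rewrite -(mem_cornery _ _ _ inj); apply: sub; apply/imsetP; exists j.
by case/imsetP => j _ ->; rewrite mem_cornery // ffunE.
Qed.

Lemma corners_above_eq0 x y T v :
  v \in T -> (forall a, x a != v) -> (forall p, y p != v) ->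
  corners_above x y T = 0%N.
Proof.
move=> vT xv yv; apply/eqP; rewrite cards_eq0; apply/eqP/setP => i.
rewrite !inE; apply/negP => /subsetP/(_ v vT); rewrite inE.
by case/orP => /imsetP [j _ e]; [have := xv j | have := yv (j, i j)];
  rewrite e eqxx.
Qed.

(** Fewer than [l] vertices cannot meet all [l] directions; in a direction [j]
    that [T] avoids, switching between the two vertices is an involution without
    fixed points on the corners containing [T]. *)
Lemma odd_corners_above x y T :
  joint_inj x y -> (#|T| < l)%N -> ~~ odd (corners_above x y T).
Proof.
move=> inj ltTl.
have [j jT] : exists j, forall b, y (j, b) \notin T.
  apply: contrapT => /forallNP all_met.
  (* [f j] is a vertex of direction [j] in [T]: the [true] one if possible. *)
  pose f j := y (j, y (j, true) \in T).
  have f_inj : injective f by case: (inj) => _ y_inj _ j j' /y_inj [].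
  have fT j : f j \in T.
    apply: contraT => fNT; case: (all_met j) => b; move: fNT; rewrite /f.
    by case: b; case: (boolP (y (j, true) \in T)) => // ->.
  have : (#|f @: [set: 'I_l]| <= #|T|)%N.
    by apply/subset_leq_card/subsetP => v /imsetP [j' _ ->].
  by rewrite card_imset // cardsT card_ord leqNgt ltTl.
pose flip i : {ffun 'I_l -> bool} := [ffun j' => (j' == j) (+) i j'].
have flipK : involutive flip.
  by move=> i; apply/ffunP => j'; rewrite !ffunE addbA addbb.
have sub_flip i : T \subset corner x y i -> T \subset corner x y (flip i).
  move=> /subsetP sub; apply/subsetP => v vT; have := sub v vT.
  rewrite !inE => /orP[->//|/imsetP [j' _ def_v]]; apply/orP; right.
  apply/imsetP; exists j' => //; rewrite ffunE.
  case: eqP => // eq_j; rewrite def_v eq_j in vT.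
  by rewrite (negbTE (jT _)) in vT.
set A := [set i | T \subset corner x y i].
pose B := [set i : {ffun 'I_l -> bool} | i j].
have flipA : A :\: B = flip @: (A :&: B).
  apply/setP => i; rewrite -{2}(flipK i) mem_imset; last exact: inv_inj.
  rewrite !inE ffunE eqxx /= andbC; congr (_ && _).
  by apply/idP/idP => /sub_flip //; rewrite flipK.
rewrite /corners_above -/A -(cardsID B A) flipA card_imset; last exact: inv_inj.
by rewrite addnn odd_double.
Qed.

End Corners.

(** * Signs of octahedra in a parity hypergraph *)

Section ParityHypergraph.
Variables (R : realType) (V : finType) (k l : nat).
Implicit Types (g : {set {set V}}) (e T : {set V}).

Definition parity_edges g : {set {set V}} :=
  [set e : {set V} | (#|e| == k) &&
     odd #|[set T in g | (#|T| == l) && (T \subset e)]|].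

Lemma parity_edges_uniform g e : e \in parity_edges g -> #|e| = k.
Proof. by rewrite inE => /andP[/eqP]. Qed.

Definition parity_hypergraph g : uniform_hypergraph k :=
  UniformHypergraph (@parity_edges_uniform g).

Lemma sign_parity_edge g e : #|e| = k ->
  (-1) ^+ (e \in parity_edges g) =
  \prod_(T : {set V} | (#|T| == l) && (T \subset e)) (-1) ^+ (T \in g) :> R.
Proof.
move=> ek; rewrite inE ek eqxx /= signr_odd -prodr_const.
rewrite [LHS](eq_bigl (fun T : {set V} =>
  ((#|T| == l) && (T \subset e)) && (T \in g)));
  last by move=> T; rewrite inE andbC.
by rewrite big_mkcondr /=; apply: eq_bigr => T _; case: (T \in g).
Qed.

(** Distinct vertices make the corners distinct [k]-sets, so the octahedron may
    be indexed by choice functions and the product over corners exchanged with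
    the product over [l]-sets. *)
Lemma octahedron_sign (d : nat) (x : {ffun 'I_(k - d) -> V})
    (y : {ffun 'I_d * bool -> V}) g :
  (d <= k)%N -> joint_inj x y ->
  (-1) ^+ #|(octahedron x y :&: parity_edges g)%SET| =
  \prod_(T : {set V} | #|T| == l)
     ((-1) ^+ (T \in g)) ^+ corners_above x y T :> R.
Proof.
move=> le_dk inj.
have -> : (-1) ^+ #|octahedron x y :&: parity_edges g| =
    \prod_(e in octahedron x y) (-1) ^+ (e \in parity_edges g) :> R.
  rewrite -prodr_const.
  rewrite [LHS](eq_bigl (fun e =>
    (e \in octahedron x y) && (e \in parity_edges g)));
    last by move=> e; rewrite inE.
  by rewrite big_mkcondr; apply: eq_bigr => e _; case: (e \in parity_edges g).
rewrite /octahedron big_imset /=; last by move=> i i' _ _; exact: corner_inj.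
under eq_bigr => i _.
  rewrite -/(corner x y i) sign_parity_edge; last by rewrite card_corner ?subnK.
  rewrite big_mkcondr /=.
over.
rewrite exchange_big /=; apply: eq_bigr => T _.
rewrite -big_mkcondr /= -prodr_const; apply: eq_bigl => i; by rewrite inE.
Qed.

Definition toggle g T : {set {set V}} := [set S : {set V} | (S \in g) (+) (S == T)].

Lemma toggleK T : involutive (toggle^~ T).
Proof. by move=> g; apply/setP => S; rewrite !inE -addbA addbb addbF. Qed.

Local Notation idx d := ('I_(k - d) + 'I_d * bool)%type.

Lemma card_idx d : (d <= k)%N -> #|{: idx d}| = (k + d)%N.
Proof. by move=> le_dk; rewrite card_sum card_prod !card_ord card_bool; lia. Qed.

Definition xpart d (h : {ffun idx d -> V}) :
  {ffun 'I_(k - d) -> V} := [ffun a => h (inl a)].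

Definition ypart d (h : {ffun idx d -> V}) :
  {ffun 'I_d * bool -> V} := [ffun p => h (inr p)].

Definition octa_sign d g (h : {ffun idx d -> V}) : R :=
  (-1) ^+ #|(octahedron (xpart h) (ypart h) :&: parity_edges g)%SET|.

Lemma deviation_sum_parity d g :
  deviation_sum R d (parity_hypergraph g) = \sum_h octa_sign (d := d) g h.
Proof. by rewrite /deviation_sum sum_ffun_split. Qed.

Lemma norm_octa_sign d g h : `|octa_sign (d := d) g h| = 1.
Proof. by rewrite normrX normrN1 expr1n. Qed.

(** Changing [g] at the [l]-set [T] multiplies the sign of each corner containing
    [T] by -1. *)
Lemma octa_sign_toggle d g T (h : {ffun idx d -> V}) :
  (d <= k)%N -> injective h -> #|T| = l ->
  octa_sign (toggle g T) h =
  (-1) ^+ corners_above (xpart h) (ypart h) T * octa_sign g h.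
Proof.
move=> le_dk /joint_inj_parts inj Tl; rewrite /octa_sign !octahedron_sign //.
rewrite [in RHS](bigD1 T) ?Tl //= [in LHS](bigD1 T) ?Tl //= mulrA; congr (_ * _).
  by rewrite inE eqxx signr_addb exprMn mulrC.
apply: eq_bigr => S /andP[_ /negbTE ST]; by rewrite inE ST addbF.
Qed.

Lemma octa_sign_succ g (h : {ffun idx l.+1 -> V}) :
  (l < k)%N -> injective h -> octa_sign g h = 1.
Proof.
move=> lt_lk /joint_inj_parts inj; rewrite /octa_sign octahedron_sign //.
apply: big1 => T /eqP Tl; rewrite exprAC -signr_odd.
by rewrite (negbTE (odd_corners_above inj _)) ?Tl // expr1n.
Qed.

(** Nondegenerate configurations contribute 1 and degenerate ones at least -1,
    hence the factor 2 in front of the number of degenerate ones. *)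
Lemma deviation_sum_succ_ge g :
  (l < k)%N ->
  #|V|%:R ^+ (k + l.+1) - 2 * (k + l.+1)%:R ^+ 2 * #|V|%:R ^+ (k + l)
    <= deviation_sum R l.+1 (parity_hypergraph g).
Proof.
move=> lt_lk; rewrite deviation_sum_parity.
apply: (@le_trans _ _
  (\sum_(h : {ffun idx l.+1 -> V}) (1 - 2 * (h \in noninj (idx l.+1) V)%:R : R))).
  rewrite sumrB sumr_const -mulr_sumr -natr_sum card_ffun -natrX.
  rewrite (card_idx lt_lk) lerD2l lerN2.
  have -> : (\sum_(h : {ffun idx l.+1 -> V}) (h \in noninj (idx l.+1) V) =
      #|noninj (idx l.+1) V|)%N.
    rewrite -sum1_card [RHS]big_mkcond.
    by apply: eq_bigr => h _; case: (h \in _).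
  rewrite -mulrA ler_pM2l // -!natrX -natrM ler_nat.
  by have := card_noninj_le (idx l.+1) V; rewrite (card_idx lt_lk) addnS.
apply: ler_sum => h _; rewrite inE.
case: injectiveP => [h_inj | _] /=.
  by rewrite octa_sign_succ // mulr0 subr0.
have : `|octa_sign g h| <= 1 by rewrite norm_octa_sign.
by rewrite ler_norml => /andP[ge_N1 _]; rewrite mulr1; lra.
Qed.

(** Toggling [g] at the top face of the first configuration is a bijection on
    families that negates the summand. Disjointness of the second configuration
    from this face needs a vertex in it, hence [0 < l]. *)
Lemma sum_octa_sign_pair (h : {ffun idx l + idx l -> V}) :
  (0 < l)%N -> (l <= k)%N -> injective h ->
  \sum_g octa_sign (d := l) g [ffun s => h (inl s)] *
         octa_sign (d := l) g [ffun s => h (inr s)] = 0.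
Proof.
move=> l_gt0 le_lk h_inj.
set h1 := [ffun s => h (inl s)]; set h2 := [ffun s => h (inr s)].
have h1_inj : injective h1 by move=> s t; rewrite !ffunE => /h_inj [].
have h2_inj : injective h2 by move=> s t; rewrite !ffunE => /h_inj [].
pose T := top_face (ypart h1).
have Tl : #|T| = l by apply: (card_top_face (joint_inj_parts h1_inj)).
have above1 : corners_above (xpart h1) (ypart h1) T = 1%N.
  exact/corners_above_top_face/joint_inj_parts.
have above2 : corners_above (xpart h2) (ypart h2) T = 0%N.
  pose j := Ordinal l_gt0.
  apply: (@corners_above_eq0 _ _ _ _ _ _ (ypart h1 (j, true))).
  - by apply/imsetP; exists j.
  - by move=> a; rewrite !ffunE; apply/eqP => /h_inj.
  - by move=> p; rewrite !ffunE; apply/eqP => /h_inj.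
set S := \sum_g _.
suff SN : S = - S by lra.
rewrite {1}/S (reindex_inj (inv_inj (toggleK T))) -sumrN /=.
apply: eq_bigr => g _.
by rewrite !octa_sign_toggle // above1 above2 expr1 expr0 mul1r mulN1r mulNr.
Qed.

(** Second moment method: the average over all [g] of the square of the
    deviation sum is at most the number of degenerate pairs of configurations. *)
Lemma ex_small_deviation_sum :
  (0 < l)%N -> (l <= k)%N ->
  exists g, deviation_sum R l (parity_hypergraph g) ^+ 2
    <= (2 * (k + l))%:R ^+ 2 * #|V|%:R ^+ (2 * (k + l)).-1.
Proof.
move=> l_gt0 le_lk.
pose degenerate_pairs := noninj (idx l + idx l)%type V.
have cardJ : #|{: idx l + idx l}| = (2 * (k + l))%N.
  by rewrite card_sum card_idx // mul2n addnn.
set B : R := _ * _.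
have noninj_le : #|degenerate_pairs|%:R <= B.
  rewrite /B -!natrX -natrM ler_nat.
  have := card_noninj_le (idx l + idx l)%type V.
  by rewrite cardJ.
apply: contrapT => /forallNP big.
have {}big g : B < deviation_sum R l (parity_hypergraph g) ^+ 2.
  by rewrite ltNge; apply/negP/big.
have : \sum_(g : {set {set V}}) B <
    \sum_g deviation_sum R l (parity_hypergraph g) ^+ 2.
  by apply: ltr_sum => //; apply/hasP; exists set0; rewrite ?mem_index_enum.
apply/negP; rewrite -leNgt.
have -> : \sum_g deviation_sum R l (parity_hypergraph g) ^+ 2 =
    \sum_(h : {ffun idx l + idx l -> V}) \sum_g
      octa_sign (d := l) g [ffun s => h (inl s)] *
      octa_sign (d := l) g [ffun s => h (inr s)].
  rewrite exchange_big /=; apply: eq_bigr => g _.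
  rewrite deviation_sum_parity expr2 big_distrlr /=.
  exact: (sum_ffun_split (fun f f' => octa_sign g f * octa_sign g f')).
apply: (@le_trans _ _
  (\sum_(h in degenerate_pairs) \sum_(g : {set {set V}}) 1)).
  rewrite (bigID (mem (degenerate_pairs))) /= addrC big1 ?add0r; last first.
    move=> h; rewrite inE negbK => /injectiveP h_inj.
    exact: sum_octa_sign_pair.
  apply: ler_sum => h _; apply: ler_sum => g _.
  by rewrite (le_trans (ler_norm _)) // normrM !norm_octa_sign mulr1.
rewrite exchange_big /=; apply: ler_sum => g _.
by rewrite sumr_const.
Qed.

End ParityHypergraph.

(** * Asymptotics *)

Section Asymptotics.
Local Open Scope classical_set_scope.

Lemma littleo_sqrt_bound (R : realType) (S : nat -> R) (C : R) (M : nat) :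
  (0 < M)%N -> (forall n, S n ^+ 2 <= C * n%:R ^+ (2 * M).-1) ->
  S =o_\oo (fun n => n%:R ^+ M : R).
Proof.
move=> M_gt0 S_le; apply/eqoP => e e_gt0.
near=> n.
(* This makes [C] at most [e ^+ 2 * n]. *)
have n_ge : C / e ^+ 2 <= n%:R by near: n; exact: nbhs_infty_ger.
have n_ge0 : 0 <= n%:R ^+ M :> R by rewrite exprn_ge0.
rewrite (ger0_norm n_ge0) -(@ler_pXn2r _ 2) ?nnegrE ?mulr_ge0 ?(ltW e_gt0) //.
rewrite real_normK ?num_real //; apply: (le_trans (S_le n)).
have -> : (e * n%:R ^+ M) ^+ 2 = e ^+ 2 * n%:R * n%:R ^+ (2 * M).-1 :> R.
  rewrite exprMn -exprM mulnC -mulrA -exprS prednK //; lia.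
apply: ler_wpM2r; first by rewrite exprn_ge0.
by rewrite mulrC -ler_pdivrMr // exprn_gt0.
Unshelve. all: by end_near.
Qed.

Lemma not_littleo_lower_bound (R : realType) (S : nat -> R) (C : R) (M : nat) :
  (forall n, n%:R ^+ M.+1 - C * n%:R ^+ M <= S n) ->
  ~ S =o_\oo (fun n => n%:R ^+ M.+1 : R).
Proof.
move=> S_ge /eqoP /(_ 2^-1) half.
have [] // := @filter_ex _ (\oo%classic) _ (fun _ => False).
near=> n.
(* This makes [C * n ^+ M] smaller than [n ^+ M.+1 / 2]. *)
have n_gt : 2 * C + 1 <= n%:R by near: n; exact: nbhs_infty_ger.
have n_gt0 : 0 < n%:R :> R by rewrite ltr0n; near: n; exact: nbhs_infty_gt.
have small : `|S n| <= 2^-1 * `|n%:R ^+ M.+1 : R|.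
  by near: n; apply: half; rewrite invr_gt0.
have p_gt0 : 0 < n%:R ^+ M :> R by rewrite exprn_gt0.
have := le_trans (S_ge n) (le_trans (ler_norm _) small).
rewrite ger0_norm; last by rewrite exprn_ge0 // ltW.
rewrite exprS.
nra.
Unshelve. all: by end_near.
Qed.

End Asymptotics.

Theorem proposition6 (R : realType) (k l : nat) :
  (2 <= l)%N -> (l <= k - 1)%N ->
  exists H : nat -> uniform_hypergraph k,
    [/\ forall n : nat, #|vertices (H n)| = n,
        deviation R l H
      & ~ deviation R l.+1 H].
Proof.
move=> le_2l le_lk1.
have [l_gt0 lt_lk] : (0 < l)%N /\ (l < k)%N by lia.
have small n : {g : {set {set 'I_n}} |
    deviation_sum R l (parity_hypergraph k l g) ^+ 2
      <= (2 * (k + l))%:R ^+ 2 * n%:R ^+ (2 * (k + l)).-1}.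
  apply: cid; have := ex_small_deviation_sum R 'I_n l_gt0 (ltnW lt_lk).
  by rewrite card_ord.
pose g n := sval (small n).
exists (fun n => parity_hypergraph k l (g n)); split.
- by move=> n; rewrite card_ord.
- apply: (@littleo_sqrt_bound _ _ ((2 * (k + l))%:R ^+ 2)) => [|n]; first by lia.
  exact: svalP (small n).
- rewrite /deviation addnS.
  apply: (@not_littleo_lower_bound _ _ (2 * (k + l.+1)%:R ^+ 2)) => n.
  by have := deviation_sum_succ_ge R (g n) lt_lk; rewrite card_ord addnS.
Qed.
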